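(* A non-trivial deformation of a $3$-Lie-Rinehart superalgebra $(L,A,[\cdot,\cdot,\cdot],\rho)$ is equivalent to a deformation whose $n$-infinitesimal cochain is not a coboundary for some $n\ge1$.
   Context: $\mathbb K$ is the base field; all vector spaces are $\mathbb Z_2$-graded, $\bar v$ is the degree of a homogeneous element (or homogeneous linear map) $v$. $Der(A)$ is the space of superderivations of $A$. In all identities the elements are homogeneous. 3-Lie superalgebra: $\mathbb Z_2$-graded space $\mathfrak g$ with an even trilinear bracket such that $[x,y,z]=-(-1)^{\bar x\bar y}[y,x,z]$, $[x,y,z]=-(-1)^{\bar y\bar z}[x,z,y]$ and the fundamental identity (FI) $[x,y,[z,u,v]]=[[x,y,z],u,v]+(-1)^{\bar z(\bar x+\bar y)}[z,[x,y,u],v]+(-1)^{(\bar z+\bar u)(\bar x+\bar y)}[z,u,[x,y,v]]$. Representation of a 3-Lie superalgebra $\mathfrak g$ on a graded space $V$: an even linear map $\rho:\mathfrak g\wedge\mathfrak g\to\mathfrak{gl}(V)$ with $\rho(x_1,x_2)\rho(x_3,x_4)-(-1)^{(\bar x_1+\bar x_2)(\bar x_3+\bar x_4)}\rho(x_3,x_4)\rho(x_1,x_2)=\rho([x_1,x_2,x_3],x_4)-(-1)^{\bar x_3\bar x_4}\rho([x_1,x_2,x_4],x_3)$ and $\rho([x_1,x_2,x_3],x_4)=\rho(x_1,x_2)\rho(x_3,x_4)+(-1)^{\bar x_1(\bar x_2+\bar x_3)}\rho(x_2,x_3)\rho(x_1,x_4)+(-1)^{\bar x_3(\bar x_1+\bar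 x_2)}\rho(x_3,x_1)\rho(x_2,x_4)$. 3-Lie-Rinehart superalgebra $(L,A,[\cdot,\cdot,\cdot],\rho)$: $A$ is an associative supercommutative superalgebra over $\mathbb K$, $L$ an $A$-module, $(L,[\cdot,\cdot,\cdot])$ a 3-Lie superalgebra, $\rho:L\times L\to Der(A)$ a representation of it on $A$, such that (R1) $\rho(ax,y)=(-1)^{\bar a\bar x}\rho(x,ay)=a\rho(x,y)$ and (R2) $[x,y,az]=(-1)^{\bar a(\bar x+\bar y)}a[x,y,z]+\rho(x,y)(a)\,z$. Deformation: a $\mathbb K[[t]]$-trilinear map $[\cdot,\cdot,\cdot]_t:L[[t]]^{3}\to L[[t]]$, $[x,y,z]_t=\sum_{i\ge0}t^im_i(x,y,z)$, with $m_0=[\cdot,\cdot,\cdot]$ and $m_i$ even trilinear maps, satisfying (FI), (R1) and (R2) with $[\cdot,\cdot,\cdot]_t$ in place of $[\cdot,\cdot,\cdot]$ and the same $\rho$. If $m_i=0$ for $1\le i\le n-1$ and $m_n$ is a non-zero cochain, then $m_n$ is called the $n$-infinitesimal of the deformation. Two deformations $[\cdot,\cdot,\cdot]_t$, $[\cdot,\cdot,\cdot]'_t$ are equivalent if there is a formal automorphism $\Phi_t=\mathrm{id}_L+\sum_{i\ge1}t^i\phi_i$ of $L[[t]]$, with $\phi_i:L\to L$ even $\mathbb K$-linear, such that $[x,y,z]'_t=\Phi_t^{-1}[\Phi_t(x),\Phi_t(y),\Phi_t(z)]_t$. A deformation is trivial if it is equivalent to the deformation $m_0=[\cdot,\cdot,\cdot]$,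 and non-trivial otherwise. Cochains and coboundaries are those of $L$ with coefficients in the adjoint module $(L,\mathrm{ad})$, $\mathrm{ad}_{x,y}(z)=[x,y,z]$. In the degrees needed here, $C^0(L,L)$ is the space of $\mathbb K$-linear maps $f:L\to L$ that are $A$-linear in the super sense, $f(ax)=(-1)^{\bar a\bar f}af(x)$. $C^1(L,L)$ is the space of super skew-symmetric $\mathbb K$-trilinear maps $f:L^3\to L$ with $f(x_1,\dots,ax_i,\dots,x_3)=(-1)^{\bar a(\bar x_1+\dots+\bar x_{i-1}+\bar f)}af(x_1,x_2,x_3)$ for $i=1,2,3$ and $a\in A$. The coboundary map $\delta_{3LR}:C^0(L,L)\to C^1(L,L)$ is $\delta_{3LR}(f)(x,y,z)=f([x,y,z])-[f(x),y,z]-(-1)^{\bar x\bar f}[x,f(y),z]-(-1)^{(\bar x+\bar y)\bar f}[x,y,f(z)]$. A trilinear cochain is a coboundary if it equals $\delta_{3LR}(f)$ for some $f\in C^0(L,L)$.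
   Formalization: The base field is assumed to have characteristic different from 2 (the claim fails in characteristic 2), and the deformed brackets are required to be super skew-symmetric, without which a deformation of an abelian algebra may have no n-infinitesimal cochain. *)

(* Defs.v *)
From HB Require Import structures.
From mathcomp Require Import all_boot all_order all_algebra.

Set Implicit Arguments.
Unset Strict Implicit.
Unset Printing Implicit Defensive.

Import GRing.Theory.
Local Open Scope ring_scope.

(* Degrees are booleans (true = odd): they are added with (+), and coerced to
   nat in the exponents of signs. *)

Record superSpace (K : fieldType) := SuperSpace {
  ss_sort :> lmodType K;
  homog : bool -> ss_sort -> Prop;
  homog0 : forall i, homog i 0;
  homogP : forall i (a : K) u v, homog i u -> homog i v -> homog i (a *: u + v);
  homog_split : forall v, exists v0 v1,
    [/\ homog false v0, homog true v1 & v = v0 + v1];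
  homog_direct : forall v, homog false v -> homog true v -> v = 0
}.

Section Multilinear.
Context (K : fieldType).

Definition bilinear2 (U V W : lmodType K) (m : U -> V -> W) : Prop :=
  (forall v, linear (m^~ v)) /\ (forall u, linear (m u)).

Definition trilinear (V : lmodType K) (m : V -> V -> V -> V) : Prop :=
  [/\ forall y z, linear (fun x => m x y z),
      forall x z, linear (fun y => m x y z)
    & forall x y, linear (fun z => m x y z)].

Definition degree1 (V : superSpace K) (d : bool) (f : V -> V) : Prop :=
  forall i x, homog i x -> homog (d (+) i) (f x).

Definition degree2 (U V W : superSpace K) (d : bool) (m : U -> V -> W) : Prop :=
  forall i j x y, homog i x -> homog j y -> homog (d (+) i (+) j) (m x y).

Definition degree3 (V : superSpace K) (d : bool) (m : V -> V -> V -> V) : Prop :=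
  forall i j k x y z, homog i x -> homog j y -> homog k z ->
    homog (d (+) i (+) j (+) k) (m x y z).

Definition super_skew3 (V : superSpace K) (m : V -> V -> V -> V) : Prop :=
  forall i j k x y z, homog i x -> homog j y -> homog k z ->
    m x y z = - ((-1) ^+ (i * j) *: m y x z) /\
    m x y z = - ((-1) ^+ (j * k) *: m x z y).

End Multilinear.

(* No unit is required, which is why this is not an algType. *)
Record scAlgebra (K : fieldType) := SCAlgebra {
  sca_sort :> superSpace K;
  amul : sca_sort -> sca_sort -> sca_sort;
  amul_bilinear : bilinear2 amul;
  amul_even : degree2 false amul;
  amulA : associative amul;
  amul_superC : forall i j a b, homog i a -> homog j b ->
    amul a b = (-1) ^+ (i * j) *: amul b a
}.

Section LieRinehart.
Context (K : fieldType).

Record is_lie3 (L : superSpace K) (br : L -> L -> L -> L) : Prop := IsLie3 {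
  lie3_trilinear : trilinear br;
  lie3_even : degree3 false br;
  lie3_skew : super_skew3 br;
  lie3_FI : forall i j k l p x y z u v,
    homog i x -> homog j y -> homog k z -> homog l u -> homog p v ->
    br x y (br z u v) =
      br (br x y z) u v
      + (-1) ^+ (k * (i + j)) *: br z (br x y u) v
      + (-1) ^+ ((k + l) * (i + j)) *: br z u (br x y v)
}.

Record is_superModule (A : scAlgebra K) (L : superSpace K)
    (act : A -> L -> L) : Prop := IsSuperModule {
  act_bilinear : bilinear2 act;
  act_even : degree2 false act;
  actA : forall a b x, act (amul a b) x = act a (act b x)
}.

Record is_rep (L V : superSpace K) (br : L -> L -> L -> L)
    (rho : L -> L -> V -> V) : Prop := IsRep {
  rep_linear : forall x y, linear (rho x y);
  rep_bilinear : forall v, bilinear2 (fun x y => rho x y v);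
  rep_even : forall i j x y, homog i x -> homog j y ->
    degree1 (i (+) j) (rho x y);
  rep_skew : forall i j x y v, homog i x -> homog j y ->
    rho x y v = - ((-1) ^+ (i * j) *: rho y x v);
  rep_comm : forall i1 i2 i3 i4 x1 x2 x3 x4 v,
    homog i1 x1 -> homog i2 x2 -> homog i3 x3 -> homog i4 x4 ->
    rho x1 x2 (rho x3 x4 v)
      - (-1) ^+ ((i1 + i2) * (i3 + i4)) *: rho x3 x4 (rho x1 x2 v)
    = rho (br x1 x2 x3) x4 v - (-1) ^+ (i3 * i4) *: rho (br x1 x2 x4) x3 v;
  rep_br : forall i1 i2 i3 i4 x1 x2 x3 x4 v,
    homog i1 x1 -> homog i2 x2 -> homog i3 x3 -> homog i4 x4 ->
    rho (br x1 x2 x3) x4 v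
    = rho x1 x2 (rho x3 x4 v)
      + (-1) ^+ (i1 * (i2 + i3)) *: rho x2 x3 (rho x1 x4 v)
      + (-1) ^+ (i3 * (i1 + i2)) *: rho x3 x1 (rho x2 x4 v)
}.

Definition superderivation (A : scAlgebra K) (d : bool) (D : A -> A) : Prop :=
  [/\ linear D, degree1 d D
    & forall i a b, homog i a ->
        D (amul a b) = amul (D a) b + (-1) ^+ (d * i) *: amul a (D b)].

Record lieRinehart3 (A : scAlgebra K) (L : superSpace K) := LieRinehart3 {
  act : A -> L -> L;
  br : L -> L -> L -> L;
  rho : L -> L -> A -> A;
  lr_module : is_superModule act;
  lr_lie3 : is_lie3 br;
  lr_rep : is_rep br rho;
  lr_der : forall i j x y, homog i x -> homog j y ->
    superderivation (i (+) j) (rho x y);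
  lr_R1 : forall h i j a x y b, homog h a -> homog i x -> homog j y ->
    rho (act a x) y b = (-1) ^+ (h * i) *: rho x (act a y) b /\
    rho (act a x) y b = amul a (rho x y b);
  lr_R2 : forall h i j k a x y z,
    homog h a -> homog i x -> homog j y -> homog k z ->
    br x y (act a z) =
      (-1) ^+ (h * (i + j)) *: act a (br x y z) + act (rho x y a) z
}.

End LieRinehart.

(* V[[t]]: the sequence of coefficients, compared with =1. *)
Definition fps (V : Type) := nat -> V.

Section Deformations.
Context (K : fieldType) (A : scAlgebra K) (L : superSpace K).
Context (R : lieRinehart3 A L).

Definition homogt (i : bool) (x : fps L) : Prop := forall n, homog i (x n).

(* The K[[t]]-trilinear extension to L[[t]] of \sum_i t^i m_i. *)
Definition brt (m : nat -> L -> L -> L -> L) (x y z : fps L) : fps L := fun n =>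
  \sum_(h < n.+1) \sum_(i < n.+1) \sum_(j < n.+1)
    \sum_(k < n.+1 | (h + i + j + k == n)%N) m h (x i) (y j) (z k).

(* rho(x, y)(a) z, with rho and the action extended K[[t]]-multilinearly. *)
Definition anchort (x y : fps L) (a : A) (z : fps L) : fps L := fun n =>
  \sum_(i < n.+1) \sum_(j < n.+1) \sum_(k < n.+1 | (i + j + k == n)%N)
    act R (rho R (x i) (y j) a) (z k).

(* (R1) involves only rho and the action, so it is already part of R. *)
Record deformation (m : nat -> L -> L -> L -> L) : Prop := Deformation {
  def_0 : forall x y z, m 0%N x y z = br R x y z;
  def_trilinear : forall i, trilinear (m i);
  def_even : forall i, degree3 false (m i);
  def_skew : forall i j k x y z, homogt i x -> homogt j y -> homogt k z ->
    forall n,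
      brt m x y z n = - ((-1) ^+ (i * j) *: brt m y x z n) /\
      brt m x y z n = - ((-1) ^+ (j * k) *: brt m x z y n);
  def_FI : forall i j k l p x y z u v,
    homogt i x -> homogt j y -> homogt k z -> homogt l u -> homogt p v ->
    forall n,
    brt m x y (brt m z u v) n =
      brt m (brt m x y z) u v n
      + (-1) ^+ (k * (i + j)) *: brt m z (brt m x y u) v n
      + (-1) ^+ ((k + l) * (i + j)) *: brt m z u (brt m x y v) n;
  def_R2 : forall h i j k a x y z,
    homog h a -> homogt i x -> homogt j y -> homogt k z ->
    forall n,
    brt m x y (fun q => act R a (z q)) n =
      (-1) ^+ (h * (i + j)) *: act R a (brt m x y z n) + anchort x y a z n
}.

(* The K[[t]]-linear extension to L[[t]] of \sum_i t^i phi_i. *)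
Definition mapt (phi : nat -> L -> L) (x : fps L) : fps L := fun n =>
  \sum_(i < n.+1) phi i (x (n - i)%N).

(* phi and psi are the coefficients of Phi_t and of its inverse. *)
Definition formal_automorphism (phi psi : nat -> L -> L) : Prop :=
  [/\ phi 0%N =1 id,
      forall i, linear (phi i),
      forall i, degree1 false (phi i)
    & forall x, mapt psi (mapt phi x) =1 x /\ mapt phi (mapt psi x) =1 x].

Definition equivalent (m m' : nat -> L -> L -> L -> L) : Prop :=
  exists phi psi, formal_automorphism phi psi /\
    forall x y z,
      brt m' x y z =1 mapt psi (brt m (mapt phi x) (mapt phi y) (mapt phi z)).

Definition undeformed (i : nat) (x y z : L) : L :=
  if i is 0%N then br R x y z else 0.

Definition trivial_deformation (m : nat -> L -> L -> L -> L) : Prop :=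
  equivalent m undeformed.

(* The homogeneous cochains of degree d. *)
Definition C0 (d : bool) (f : L -> L) : Prop :=
  [/\ linear f, degree1 d f
    & forall h a x, homog h a -> f (act R a x) = (-1) ^+ (h * d) *: act R a (f x)].

Definition C1 (d : bool) (f : L -> L -> L -> L) : Prop :=
  [/\ trilinear f, degree3 d f, super_skew3 f
    & forall h i j k a x y z,
        homog h a -> homog i x -> homog j y -> homog k z ->
        [/\ f (act R a x) y z = (-1) ^+ (h * d) *: act R a (f x y z),
            f x (act R a y) z = (-1) ^+ (h * (i + d)) *: act R a (f x y z)
          & f x y (act R a z) = (-1) ^+ (h * (i + j + d)) *: act R a (f x y z)]].

(* delta_{3LR} f at x, y, z, for f, x, y homogeneous of degrees d, i, j. *)
Definition delta3LR (d : bool) (f : L -> L) (i j : bool) (x y z : L) : L :=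
  f (br R x y z) - br R (f x) y z - (-1) ^+ (i * d) *: br R x (f y) z
  - (-1) ^+ ((i + j) * d) *: br R x y (f z).

(* An element of C^0(L, L) is the sum of its even part f0 and odd part f1. *)
Definition coboundary (g : L -> L -> L -> L) : Prop :=
  exists f0 f1, [/\ C0 false f0, C0 true f1
    & forall i j k x y z, homog i x -> homog j y -> homog k z ->
        g x y z = delta3LR false f0 i j x y z + delta3LR true f1 i j x y z].

(* m n is the n-infinitesimal of the deformation m. *)
Definition infinitesimal (m : nat -> L -> L -> L -> L) (n : nat) : Prop :=
  [/\ (1 <= n)%N,
      forall i, (1 <= i < n)%N -> forall x y z, m i x y z = 0,
      C1 false (m n)
    & exists x y z, m n x y z <> 0].

End Deformations.

(* Main.v *)
(* If every n-infinitesimal of every deformation equivalent to m were a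
   coboundary delta f, one could remove the terms of m one degree at a time: an
   automorphism 1 + t^n f + O(t^(n+1)) replaces m_n by m_n - delta f = 0, and the
   infinite composite of these automorphisms converges t-adically, making m
   trivial.  The conjugate bracket must satisfy (R2) with the same anchor rho, so
   the automorphism has to preserve rho(x, y)(a) z.  Since m_n = delta f is
   A-linear, f is skew for this form, and the Cayley transform
   (1 + t^n f/2) (1 - t^n f/2)^-1 does preserve it; this is where 2 <> 0 is used. *)

Require Import Defs.
From HB Require Import structures.
From mathcomp Require Import all_boot all_order all_algebra.
From Stdlib Require Import FunctionalExtensionality Classical ClassicalEpsilon.

Set Implicit Arguments.
Unset Strict Implicit.
Unset Printing Implicit Defensive.

Import GRing.Theory.
Local Open Scope ring_scope.

(** * Elementary consequences of linearity *)

Lemma linear_f0 (K : fieldType) (U V : lmodType K) (f : U -> V) :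
  linear f -> f 0 = 0.
Proof. by move=> lf; have := lf (-1) 0 0; rewrite !scaleN1r !addNr. Qed.

Lemma linear_fD (K : fieldType) (U V : lmodType K) (f : U -> V) :
  linear f -> {morph f : x y / x + y}.
Proof. by move=> lf x y; rewrite -[x]scale1r lf !scale1r. Qed.

Lemma linear_fZ (K : fieldType) (U V : lmodType K) (f : U -> V) :
  linear f -> forall a, {morph f : x / a *: x}.
Proof. by move=> lf a x; rewrite -[_ *: _]addr0 lf (linear_f0 lf) addr0. Qed.

Lemma linear_fN (K : fieldType) (U V : lmodType K) (f : U -> V) :
  linear f -> {morph f : x / - x}.
Proof. by move=> lf x; rewrite -!scaleN1r (linear_fZ lf). Qed.

(** * Formal power series and [K[[t]]]-linear operators on them *)

Section PowerSeries.
Context (K : fieldType) (V : lmodType K).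
Implicit Types (x y z : fps V) (S T : fps V -> fps V).

(* a x + t^s y *)
Definition comb (a : K) (s : nat) x y : fps V := fun n =>
  a *: x n + (if (s <= n)%N then y (n - s)%N else 0).

Definition const (u : V) : fps V := fun n => if n is 0%N then u else 0.

(* K[[t]]-linearity. No continuity is required: peeling off constant terms one
   at a time already determines every coefficient of T x. *)
Definition tlinear T : Prop :=
  forall a s x y, T (comb a s x y) = comb a s (T x) (T y).

Lemma fps_split x : x = comb 1 1 (const (x 0%N)) (fun n => x n.+1).
Proof.
apply: functional_extensionality => -[|n]; rewrite /comb /= scale1r ?addr0 //.
by rewrite add0r subn1.
Qed.

Lemma const_comb a u v : const (a *: u + v) = comb a 0 (const u) (const v).
Proof.
apply: functional_extensionality => -[|n]; rewrite /comb //= scaler0 addr0 //.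
Qed.

Lemma tlinear_tail T x n : tlinear T ->
  T x n = T (const (x 0%N)) n
          + (if n is n'.+1 then T (fun k => x k.+1) n' else 0).
Proof.
move=> tT; rewrite {1}(fps_split x) tT /comb scale1r.
by case: n => [|n] //=; rewrite subn1.
Qed.

Lemma tlinear_ext S T : tlinear S -> tlinear T ->
  (forall u, S (const u) = T (const u)) -> forall x, S x = T x.
Proof.
move=> tS tT eST x; apply: functional_extensionality => n.
elim: n x => [|n IHn] x; rewrite (tlinear_tail _ _ tS) (tlinear_tail _ _ tT) eST //.
by rewrite IHn.
Qed.

(** Continuity comes for free: peeling off the constant terms of a series up to degree n leaves
    [t^(n+1)] times a tail, whose image does not reach coefficient n. *)
Lemma tlinear_causal T n x y : tlinear T ->
  (forall k, (k <= n)%N -> x k = y k) -> T x n = T y n.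
Proof.
move=> tT; elim: n x y => [|n IHn] x y exy;
  rewrite (tlinear_tail x _ tT) (tlinear_tail y _ tT) exy //.
by congr (_ + _); apply: IHn => k kn; apply: exy.
Qed.

Lemma tlinear_id : tlinear id.
Proof. by []. Qed.

Lemma tlinear_comp S T : tlinear S -> tlinear T -> tlinear (S \o T).
Proof. by move=> tS tT a s x y /=; rewrite tT tS. Qed.

Lemma tlinear_map (g : V -> V) : linear g -> tlinear (fun x n => g (x n)).
Proof.
move=> lg a s x y; apply: functional_extensionality => n; rewrite /comb lg.
by case: ifP => _; rewrite ?(linear_f0 lg).
Qed.

Lemma tlinear0 T : tlinear T -> T (fun=> 0) = fun=> 0.
Proof.
move=> tT; have {1}-> : (fun=> 0) = comb (-1) 0 (fun=> 0) (fun=> 0) :> fps V.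
  by apply: functional_extensionality => n; rewrite /comb /= scaler0 addr0.
rewrite tT; apply: functional_extensionality => n.
by rewrite /comb /= subn0 scaleN1r addNr.
Qed.

Lemma tlinearP T a x y : tlinear T ->
  T (fun n => a *: x n + y n) = fun n => a *: T x n + T y n.
Proof.
move=> tT; have eq0 (p q : fps V) : (fun n => a *: p n + q n) = comb a 0 p q.
  by apply: functional_extensionality => n; rewrite /comb subn0.
by rewrite !eq0 tT.
Qed.

Lemma tlinearZ T a x : tlinear T -> T (fun n => a *: x n) = fun n => a *: T x n.
Proof.
move=> tT; have := tlinearP a x (fun=> 0) tT; rewrite tlinear0 // => e.
apply: functional_extensionality => n; have := congr1 (@^~ n) e.
rewrite /= addr0 => <-; congr (T _ n).
by apply: functional_extensionality => k; rewrite addr0.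
Qed.

Lemma tlinear_comb n S T : tlinear S -> tlinear T ->
  tlinear (fun x => comb 1 n (S x) (T x)).
Proof.
move=> tS tT a s x y; rewrite tS tT; apply: functional_extensionality => k.
rewrite /comb !scale1r scalerDr -!addrA; congr (_ + _).
(* The shifts by n and by s commute, and a doubly shifted coefficient survives only when
   [n + s <= k]. *)
case: (leqP n k) => nk; case: (leqP s k) => sk;
  rewrite ?scaler0 ?add0r ?addr0 //.
- rewrite addrCA subnAC; congr (_ + (_ + _)).
  by rewrite !leq_subRL // addnC.
- by rewrite leq_subRL // leqNgt ltn_addl // addr0.
by rewrite leq_subRL // leqNgt ltn_addl // addr0.
Qed.

(** Fixed-point iteration for [y = x - (T - 1) y]. When T preserves constant terms, [T - 1] raises
    the order in t, so N iterations settle all coefficients below N. *)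
Fixpoint tinv_iter T x (N : nat) : fps V :=
  if N is N'.+1 then fun k => x k - (T (tinv_iter T x N') k - tinv_iter T x N' k)
  else x.

Definition tinv T x : fps V := fun k => tinv_iter T x k.+1 k.

Section Inverse.
Variable T : fps V -> fps V.
Hypotheses (tT : tlinear T) (T0 : forall x, T x 0%N = x 0%N).

(** The difference of the two series is [t^k w], and by [T0] the operator keeps the constant term of
    w; so T contributes exactly [x k - y k] to coefficient k. *)
Lemma tlinear_unipotent k x y : (forall i, (i < k)%N -> x i = y i) ->
  T x k - x k = T y k - y k.
Proof.
move=> exy; pose w : fps V := fun i => x (k + i)%N - y (k + i)%N.
have -> : x = comb 1 k y w.
  apply: functional_extensionality => i; rewrite /comb scale1r /w.
  case: leqP => [ki|/exy->]; last by rewrite addr0.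
  by rewrite subnKC // addrC subrK.
by rewrite tT /comb leqnn subnn T0 !scale1r opprD addrACA subrr addr0.
Qed.

Lemma tinv_iter_stable x N k : (k < N)%N ->
  tinv_iter T x N.+1 k = tinv_iter T x N k.
Proof.
elim: N k => [//|N IHN] k; rewrite ltnS => kN.
rewrite -[LHS]/(x k - _) -[RHS]/(x k - _); congr (_ - _).
by apply: tlinear_unipotent => i ik; apply: IHN; apply: leq_trans kN.
Qed.

Lemma tinv_iterE x N k : (k < N)%N -> tinv_iter T x N k = tinv T x k.
Proof.
elim: N => [//|N IHN]; rewrite ltnS leq_eqVlt => /orP[/eqP-> //|kN].
by rewrite tinv_iter_stable // IHN.
Qed.

Lemma tinvK x : T (tinv T x) = x.
Proof.
apply: functional_extensionality => k.
have e : T (tinv_iter T x k) k - tinv_iter T x k k = T (tinv T x) k - tinv T x k.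
  by apply: tlinear_unipotent => i ik; apply: tinv_iterE.
have : tinv T x k = x k - (T (tinv_iter T x k) k - tinv_iter T x k k) by [].
rewrite e => /eqP; rewrite eq_sym subr_eq addrC subrK => /eqP //.
Qed.

Lemma tlinear_inj x y : T x = T y -> x = y.
Proof.
move=> eT; apply: functional_extensionality => k.
have [n] := ubnP k; elim: n k => [//|n IHn] k; rewrite ltnS => kn.
have /tlinear_unipotent : forall i, (i < k)%N -> x i = y i.
  by move=> i ik; apply: IHn; apply: leq_trans kn.
by rewrite eT => /addrI/oppr_inj.
Qed.

Lemma tinvKV x : tinv T (T x) = x.
Proof. by apply: tlinear_inj; rewrite tinvK. Qed.

Lemma tinv_tlinear : tlinear (tinv T).
Proof.
by move=> a s x y; apply: tlinear_inj; rewrite tinvK tT !tinvK.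
Qed.

End Inverse.

Definition tlinear3 (B : fps V -> fps V -> fps V -> fps V) : Prop :=
  [/\ forall y z, tlinear (fun x => B x y z),
      forall x z, tlinear (fun y => B x y z)
    & forall x y, tlinear (B x y)].

Lemma tlinear3_ext B C : tlinear3 B -> tlinear3 C ->
  (forall u v w, B (const u) (const v) (const w) = C (const u) (const v) (const w)) ->
  forall x y z, B x y z = C x y z.
Proof.
move=> [B1 B2 B3] [C1 C2 C3] e x y z.
apply: (tlinear_ext (B1 y z) (C1 y z)) => u.
apply: (tlinear_ext (B2 _ z) (C2 _ z)) => v.
exact: (tlinear_ext (B3 _ _) (C3 _ _)).
Qed.

Lemma tlinear3_conj B F G : tlinear3 B -> tlinear F -> tlinear G ->
  tlinear3 (fun x y z => G (B (F x) (F y) (F z))).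
Proof.
move=> [B1 B2 B3] tF tG; split=> [y z|x z|x y] a s u v.
- by rewrite tF B1 tG.
- by rewrite tF B2 tG.
by rewrite tF B3 tG.
Qed.

End PowerSeries.

(** * Homogeneous elements, and equalities tested on them *)

Section Homogeneous.
Context (K : fieldType) (V : superSpace K).

Lemma homogZ i (a : K) (u : V) : homog i u -> homog i (a *: u).
Proof. by move=> hu; rewrite -[_ *: _]addr0; apply: homogP (homog0 V i). Qed.

Lemma homogD i (u v : V) : homog i u -> homog i v -> homog i (u + v).
Proof. by move=> hu; rewrite -[u in u + _]scale1r; apply: homogP. Qed.

Lemma homogN i (u : V) : homog i u -> homog i (- u).
Proof. by rewrite -scaleN1r; apply: homogZ. Qed.

Lemma homog_sum i (I : Type) (r : seq I) (P : pred I) (F : I -> V) :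
  (forall k, P k -> homog i (F k)) -> homog i (\sum_(k <- r | P k) F k).
Proof. by move=> hF; apply: big_ind => //; [apply: homog0 | apply: homogD]. Qed.

Lemma homogt_const i (u : V) : homog i u -> homogt i (const u).
Proof. by move=> hu [|n] //=; apply: homog0. Qed.

Lemma linear_homog_eq (W : lmodType K) (f g : V -> W) : linear f -> linear g ->
  (forall i x, homog i x -> f x = g x) -> forall x, f x = g x.
Proof.
move=> lf lg e x; have [v0 [v1 [h0 h1 ->]]] := homog_split x.
by rewrite -[v0]scale1r lf lg (e _ _ h0) (e _ _ h1).
Qed.

Lemma trilinear_homog_eq (b c : V -> V -> V -> V) : trilinear b -> trilinear c ->
  (forall i j k x y z, homog i x -> homog j y -> homog k z -> b x y z = c x y z) ->
  forall x y z, b x y z = c x y z.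
Proof.
move=> [b1 b2 b3] [c1 c2 c3] e x y z.
apply: (linear_homog_eq (b1 y z) (c1 y z)) => i {}x hx.
apply: (linear_homog_eq (b2 x z) (c2 x z)) => j {}y hy.
by apply: (linear_homog_eq (b3 x y) (c3 x y)) => k {}z; apply: e hx hy.
Qed.

End Homogeneous.

(** * The [K[[t]]]-trilinear extension of a family of brackets *)

Section Bracket.
Context (K : fieldType) (L : superSpace K).
Implicit Types (m : nat -> L -> L -> L -> L) (x y z : fps L).

(** Exchanging arguments reduces linearity in the second and third variables to linearity in the
    first. *)
Lemma brt_swap12 m x y z : brt m x y z = brt (fun h u v w => m h v u w) y x z.
Proof.
apply: functional_extensionality => n; rewrite /brt; apply: eq_bigr => h _.
rewrite exchange_big /=; apply: eq_bigr => j _; apply: eq_bigr => i _.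
by apply: eq_bigl => k; rewrite addnAC -!addnA (addnC j) !addnA addnAC.
Qed.

Lemma brt_swap23 m x y z : brt m x y z = brt (fun h u v w => m h u w v) x z y.
Proof.
apply: functional_extensionality => n; rewrite /brt; apply: eq_bigr => h _.
apply: eq_bigr => i _.
under eq_bigr do rewrite big_mkcond.
rewrite exchange_big; apply: eq_bigr => k _; rewrite [RHS]big_mkcond.
by apply: eq_bigr => j _; rewrite addnAC.
Qed.

Lemma sum_narrow (N M : nat) (F : nat -> L) : (N <= M)%N ->
  (forall i, (N <= i)%N -> F i = 0) -> \sum_(i < M) F i = \sum_(i < N) F i.
Proof.
move=> NM F0; rewrite -!(big_mkord xpredT) (big_cat_nat (n := N)) //=.
rewrite [X in _ + X]big_nat_cond [X in _ + X]big1 ?addr0 // => i /andP[/andP[Ni _] _].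
exact: F0.
Qed.

(** The four bounds are kept apart from the weight n so that a single index can be shifted; by
    [sum4_narrow] any bounds above n give the same sum. *)
Definition sum4 (N1 N2 N3 N4 n : nat) (F : nat -> nat -> nat -> nat -> L) : L :=
  \sum_(h < N1) \sum_(i < N2) \sum_(j < N3) \sum_(k < N4)
    if (h + i + j + k == n)%N then F h i j k else 0.

Lemma sum4_narrow N1 N2 N3 N4 n F :
  (n < N1)%N -> (n < N2)%N -> (n < N3)%N -> (n < N4)%N ->
  sum4 N1 N2 N3 N4 n F = sum4 n.+1 n.+1 n.+1 n.+1 n F.
Proof.
move=> l1 l2 l3 l4; rewrite /sum4.
have far (h i j k p : nat) u : (n < p)%N -> (p <= h + i + j + k)%N ->
    (if (h + i + j + k == n)%N then u else 0) = 0 :> L.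
  by move=> np ph; case: eqP => // e; move: ph; rewrite e leqNgt np.
rewrite (sum_narrow (F := fun h => \sum_(i < N2) \sum_(j < N3) \sum_(k < N4)
  if (h + i + j + k == n)%N then F h i j k else 0) l1) => [|h nh]; last first.
  do 3![apply: big1 => ? _]; apply: far nh _; by rewrite -!addnA leq_addr.
apply: eq_bigr => h _.
rewrite (sum_narrow (F := fun i => \sum_(j < N3) \sum_(k < N4)
  if (h + i + j + k == n)%N then F h i j k else 0) l2) => [|i ni]; last first.
  do 2![apply: big1 => ? _]; apply: far ni _.
  by rewrite (addnC h) -!addnA leq_addr.
apply: eq_bigr => i _.
rewrite (sum_narrow (F := fun j => \sum_(k < N4)
  if (h + i + j + k == n)%N then F h i j k else 0) l3) => [|j nj]; last first.
  apply: big1 => ? _; apply: far nj _.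
  by rewrite (addnC (h + i)%N) -!addnA leq_addr.
apply: eq_bigr => j _.
rewrite (sum_narrow (F := fun k =>
  if (h + i + j + k == n)%N then F h i j k else 0) l4) => [|k nk] //.
by apply: far nk _; rewrite leq_addl.
Qed.

Lemma brtE m x y z n :
  brt m x y z n = sum4 n.+1 n.+1 n.+1 n.+1 n (fun h i j k => m h (x i) (y j) (z k)).
Proof. by do 3![apply: eq_bigr => ? _]; rewrite big_mkcond. Qed.

Lemma brt_tlinear1 m y z : (forall h v w, linear (fun u => m h u v w)) ->
  tlinear (fun x => brt m x y z).
Proof.
move=> lm a s x x'; apply: functional_extensionality => n.
pose sh i := if (s <= i)%N then x' (i - s)%N else 0.
have -> : brt m (comb a s x x') y z n = a *: brt m x y z n + brt m sh y z n.
  rewrite /brt; do 3![rewrite scaler_sumr -big_split; apply: eq_bigr => ? _ /=].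
  by rewrite scaler_sumr -big_split; apply: eq_bigr => ? _; rewrite /comb lm.
congr (_ + _); rewrite brtE; case: leqP => [sn|ns]; last first.
  (* A term of weight n has [i <= n < s], where the shifted series vanishes. *)
  apply: big1 => h _; apply: big1 => i _; apply: big1 => j _; apply: big1 => k _.
  case: eqP => // e; rewrite /sh ifN ?(linear_f0 (lm _ _ _)) // -ltnNge.
  by apply: leq_ltn_trans ns; rewrite -[leqRHS]e (addnC (h : nat)) -!addnA leq_addr.
rewrite -(subnKC sn); set p := (n - s)%N; rewrite addKn brtE.
(* The bounds for weight p are lengthened to those for weight [s + p], except the one for i: on the
   other side its range splits into s vanishing terms and [p.+1] shifted ones. *)
rewrite -(sum4_narrow (n := p) (N1 := (s + p).+1) (N2 := p.+1) (N3 := (s + p).+1)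
  (N4 := (s + p).+1)) ?ltnS ?leq_addl //.
apply: eq_bigr => -[h _] _ /=; rewrite -addnS big_split_ord /= big1 ?add0r => [|i _].
  apply: eq_bigr => i _; do 2![apply: eq_bigr => ? _].
  rewrite /sh leq_addr addKn; congr (if _ then _ else _).
  by rewrite (addnCA h) -!addnA eqn_add2l.
do 2![apply: big1 => ? _].
by rewrite /sh leqNgt ltn_ord /= (linear_f0 (lm _ _ _)) if_same.
Qed.

Lemma brt_tlinear3 m : (forall h, trilinear (m h)) -> tlinear3 (brt m).
Proof.
move=> lm; split=> [y z|x z|x y] a s u v.
- by apply: brt_tlinear1 => h p q; case: (lm h).
- rewrite !(brt_swap12 m x).
  by apply: (brt_tlinear1 (m := fun h u v w => m h v u w)) => h p q; case: (lm h).
rewrite !(brt_swap23 m x) !(brt_swap12 _ x).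
by apply: (brt_tlinear1 (m := fun h u v w => m h v w u)) => h p q; case: (lm h).
Qed.

Lemma brt_const m : (forall h, trilinear (m h)) -> forall u v w n,
  brt m (const u) (const v) (const w) n = m n u v w.
Proof.
move=> lm u v w n.
have m1 h p q : m h 0 p q = 0 by have [lh _ _] := lm h; apply: linear_f0 (lh p q).
have m2 h p q : m h p 0 q = 0 by have [_ lh _] := lm h; apply: linear_f0 (lh p q).
have m3 h p q : m h p q 0 = 0 by have [_ _ lh] := lm h; apply: linear_f0 (lh p q).
rewrite brtE /sum4.
under eq_bigr => h _.
  rewrite big_ord_recl [X in _ + X]big1 ?addr0 => [|i _]; last first.
    by do 2![apply: big1 => ? _]; rewrite m1 if_same.
  rewrite big_ord_recl [X in _ + X]big1 ?addr0 => [|i _]; last first.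
    by apply: big1 => ? _; rewrite m2 if_same.
  rewrite big_ord_recl [X in _ + X]big1 ?addr0 => [|i _]; last first.
    by rewrite m3 if_same.
  rewrite /= !addn0; over.
rewrite (bigD1 ord_max) //= eqxx big1 ?addr0 // => h.
by rewrite -val_eqE /= => /negPf->.
Qed.

Lemma brt_coef0 m x y z : brt m x y z 0%N = m 0%N (x 0%N) (y 0%N) (z 0%N).
Proof. by rewrite brtE /sum4 !big_ord1. Qed.

Lemma brt_homogt m : (forall h, degree3 false (m h)) -> forall i j k x y z,
  homogt i x -> homogt j y -> homogt k z -> homogt (i (+) j (+) k) (brt m x y z).
Proof.
move=> dm i j k x y z hx hy hz n.
do 4![apply: homog_sum => ? _]; exact: (dm _ i j k).
Qed.

End Bracket.

(** * Even automorphisms of [L[[t]]] and conjugation of brackets *)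

Section Automorphisms.
Context (K : fieldType) (L : superSpace K).
Implicit Types (F G T : fps L -> fps L).

(** Operators on whole series make composition, inversion and limits direct; [aut_formal] translates
    back to sequences of coefficients. *)
Record automorphismt F G : Prop := Automorphismt {
  aut_tlinear : tlinear F;
  aut_tlinearV : tlinear G;
  autK : cancel F G;
  autVK : cancel G F;
  aut_lead : forall x, F x 0%N = x 0%N;
  aut_even : forall i x, homogt i x -> homogt i (F x);
  aut_evenV : forall i x, homogt i x -> homogt i (G x)
}.

Lemma aut_leadV F G : automorphismt F G -> forall x, G x 0%N = x 0%N.
Proof. by move=> a x; rewrite -(aut_lead a) (autVK a). Qed.

Lemma aut_sym F G : automorphismt F G -> automorphismt G F.
Proof. by move=> a; case: (a) => *; split=> //; apply: aut_leadV a. Qed.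

Lemma aut_comp F G F' G' : automorphismt F G -> automorphismt F' G' ->
  automorphismt (F \o F') (G' \o G).
Proof.
move=> [tF tG FK GK lF eF eG] [tF' tG' FK' GK' lF' eF' eG'].
split=> //=; do ?exact: tlinear_comp.
- exact: can_comp.
- exact: can_comp.
- by move=> x /=; rewrite lF lF'.
- by move=> i x hx; apply/eF/eF'.
by move=> i x hx; apply/eG'/eG.
Qed.

Lemma tinv_even (T : fps L -> fps L) : (forall i x, homogt i x -> homogt i (T x)) ->
  forall i x, homogt i x -> homogt i (tinv T x).
Proof.
move=> eT i x hx k; suff hN N : homogt i (tinv_iter T x N) by apply: hN.
elim: N => [//|N IHN] n /=; apply: homogD => //; apply/homogN/homogD.
  exact: eT.
exact: homogN.
Qed.

Lemma aut_tinv (T : fps L -> fps L) : tlinear T -> (forall x, T x 0%N = x 0%N) ->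
  (forall i x, homogt i x -> homogt i (T x)) -> automorphismt T (tinv T).
Proof.
move=> tT lT eT; split=> //; first exact: tinv_tlinear.
- exact: tinvKV.
- exact: tinvK.
exact: tinv_even.
Qed.

Definition coeft F (n : nat) (u : L) : L := F (const u) n.

Lemma mapt_coeft F : tlinear F -> forall x, mapt (coeft F) x =1 F x.
Proof.
move=> tF x n; elim: n x => [|n IHn] x.
  by rewrite /mapt big_ord1 (tlinear_tail _ _ tF) addr0.
rewrite (tlinear_tail _ _ tF) -IHn /mapt big_ord_recr /= subnn addrC.
by congr (_ + _); apply: eq_bigr => -[i /= ilt] _; rewrite subSn.
Qed.

Lemma coeft_linear F : tlinear F -> forall n, linear (coeft F n).
Proof.
by move=> tF n a u v; rewrite /coeft const_comb tF /comb subn0.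
Qed.

Lemma aut_formal F G : automorphismt F G -> formal_automorphism (coeft F) (coeft G).
Proof.
move=> a; have tF := aut_tlinear a; have tG := aut_tlinearV a.
have eF x : mapt (coeft F) x = F x.
  exact/functional_extensionality/mapt_coeft.
have eG x : mapt (coeft G) x = G x.
  exact/functional_extensionality/mapt_coeft.
split=> [u||i j u hu|x].
- by rewrite /coeft (aut_lead a).
- exact: coeft_linear.
- by apply: aut_even a _ _ _ _; apply: homogt_const.
by rewrite !(eF, eG) (autK a) (autVK a).
Qed.

Lemma aut_equivalent F G m m' : automorphismt F G ->
  (forall x y z, brt m' x y z = G (brt m (F x) (F y) (F z))) -> equivalent m m'.
Proof.
move=> a e; exists (coeft F), (coeft G); split; first exact: aut_formal.
move=> x y z n; rewrite mapt_coeft ?e; last exact: aut_tlinearV a.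
have eF w : mapt (coeft F) w = F w.
  exact/functional_extensionality/mapt_coeft/aut_tlinear/a.
by rewrite !eF.
Qed.

(** Coefficients are read off on constant series. This loses nothing: in [brt_conj] both sides are
    t-trilinear, hence determined by constants. *)
Definition conj_bracket F G (m : nat -> L -> L -> L -> L) n (x y z : L) : L :=
  G (brt m (F (const x)) (F (const y)) (F (const z))) n.

Lemma tlinear3_trilinear (B : fps L -> fps L -> fps L -> fps L) n : tlinear3 B ->
  trilinear (fun x y z => B (const x) (const y) (const z) n).
Proof.
move=> [B1 B2 B3]; split=> [y z|x z|x y] a u v; rewrite const_comb.
- by rewrite B1 /comb subn0.
- by rewrite B2 /comb subn0.
by rewrite B3 /comb subn0.
Qed.

Section Conjugation.
Variables (F G : fps L -> fps L) (m : nat -> L -> L -> L -> L).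
Hypotheses (a : automorphismt F G) (lm : forall i, trilinear (m i)).

Lemma conj_bracket_trilinear i : trilinear (conj_bracket F G m i).
Proof.
apply: (tlinear3_trilinear (B := fun x y z => G (brt m (F x) (F y) (F z)))).
by case: a => *; apply: tlinear3_conj => //; apply: brt_tlinear3.
Qed.

Lemma brt_conj x y z :
  brt (conj_bracket F G m) x y z = G (brt m (F x) (F y) (F z)).
Proof.
move: x y z; apply: tlinear3_ext.
- exact/brt_tlinear3/conj_bracket_trilinear.
- by case: a => *; apply: tlinear3_conj => //; apply: brt_tlinear3.
move=> u v w; apply: functional_extensionality => n.
by rewrite brt_const //; apply: conj_bracket_trilinear.
Qed.

End Conjugation.

End Automorphisms.

(** * Transport of deformations by automorphisms respecting the action and the anchor *)

Section LieRinehartDeformations.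
Context (K : fieldType) (A : scAlgebra K) (L : superSpace K).
Context (R : lieRinehart3 A L).
Implicit Types (m : nat -> L -> L -> L -> L) (x y z : fps L).

Definition actt (a : A) z : fps L := fun n => act R a (z n).

Definition anchor (a : A) (u v w : L) : L := act R (rho R u v a) w.

Lemma act_linearl (w : L) : linear (fun a : A => act R a w).
Proof. by have [/(_ w)] := act_bilinear (lr_module R). Qed.

Lemma act_linear (a : A) : linear (act R a).
Proof. by have [_ /(_ a)] := act_bilinear (lr_module R). Qed.

Lemma actt_tlinear (a : A) : tlinear (actt a).
Proof. exact/tlinear_map/act_linear. Qed.

Lemma anchor_trilinear (a : A) : trilinear (anchor a).
Proof.
have [rl rr] := rep_bilinear (lr_rep R) a.
split=> [v w|u w|u v] c p q; rewrite /anchor.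
- by rewrite (rl v) act_linearl.
- by rewrite (rr u) act_linearl.
exact: act_linear.
Qed.

(* This bracket makes anchort an instance of brt. *)
Definition anchor_series (a : A) (n : nat) (u v w : L) : L :=
  if n is 0%N then anchor a u v w else 0.

Lemma anchor_series_trilinear (a : A) n : trilinear (anchor_series a n).
Proof.
case: n => [|n]; first exact: anchor_trilinear.
by split=> ? ? ? ? ?; rewrite /= scaler0 addr0.
Qed.

Lemma anchort_brt (a : A) x y z : anchort R x y a z = brt (anchor_series a) x y z.
Proof.
apply: functional_extensionality => n; rewrite /brt big_ord_recl.
by rewrite [X in _ + X]big1 ?addr0 // => h _; do 3![apply: big1 => ? _].
Qed.

Lemma anchort_tlinear3 (a : A) : tlinear3 (fun x y => anchort R x y a).
Proof.
have [a1 a2 a3] := brt_tlinear3 (anchor_series_trilinear a).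
by split=> [y z|x z|x y] c s u v; rewrite !anchort_brt ?a1 ?a2 ?a3.
Qed.

(** With its first two arguments constant, the anchor form is the action of a single element of [A],
    so facts about the action carry over to it. *)
Lemma anchort_const (a : A) (u v : L) z :
  anchort R (const u) (const v) a z = actt (rho R u v a) z.
Proof.
have [_ _ a3] := anchort_tlinear3 a.
apply: (tlinear_ext (a3 _ _) (actt_tlinear _)) => w.
apply: functional_extensionality => n.
rewrite anchort_brt brt_const; last exact: anchor_series_trilinear.
by case: n => [|n] //=; rewrite /actt (linear_f0 (act_linear _)).
Qed.

Section Transport.
Variables (F G : fps L -> fps L) (m : nat -> L -> L -> L -> L).
Hypotheses (aFG : automorphismt F G) (dm : deformation R m).
Hypothesis F_actt : forall a z, F (actt a z) = actt a (F z).
Hypothesis F_anchort : forall a x y z, anchort R (F x) (F y) a z = anchort R x y a z.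

Lemma automorphismV_actt a z : G (actt a z) = actt a (G z).
Proof. by rewrite -[z in LHS](autVK aFG) -F_actt (autK aFG). Qed.

(** For constant x and y this is commutation of G with the action of [rho R u v a]; t-linearity in x
    and y does the rest. *)
Lemma automorphismV_anchort a x y z :
  G (anchort R x y a z) = anchort R x y a (G z).
Proof.
have tG := aut_tlinearV aFG; have [a1 a2 _] := anchort_tlinear3 a.
have t1 y' : tlinear (fun x => G (anchort R x y' a z)) by apply: tlinear_comp.
have t2 x' : tlinear (fun y => G (anchort R x' y a z)) by apply: tlinear_comp.
apply: (tlinear_ext (t1 y) (a1 y _)) => u.
apply: (tlinear_ext (t2 (const u)) (a2 _ _)) => v.
by rewrite !anchort_const automorphismV_actt.
Qed.

Lemma deformation_conj : deformation R (conj_bracket F G m).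
Proof.
have lm := def_trilinear dm; have tG := aut_tlinearV aFG.
have eF := aut_even aFG; have eG := aut_evenV aFG.
have bE := brt_conj aFG lm.
split.
- move=> x y z; rewrite /conj_bracket (aut_leadV aFG) brt_coef0 !(aut_lead aFG).
  exact: def_0 dm _ _ _.
- exact: conj_bracket_trilinear.
- move=> n i j k x y z hx hy hz; apply: eG.
  by apply: (brt_homogt (def_even dm)); apply: eF; apply: homogt_const.
- move=> i j k x y z hx hy hz n; rewrite !bE.
  have sk := def_skew dm (eF _ _ hx) (eF _ _ hy) (eF _ _ hz).
  have GN c w w' : w = (fun n => - (c *: w' n)) -> G w n = - (c *: G w' n).
    move=> ->; have -> : (fun n => - (c *: w' n)) = fun n => - c *: w' n.
      by apply: functional_extensionality => ?; rewrite scaleNr.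
    by rewrite tlinearZ // scaleNr.
  split; apply: GN; apply: functional_extensionality => k'; first by case: (sk k').
  by case: (sk k').
- move=> i j k l p x y z u v hx hy hz hu hv n; rewrite !bE !(autVK aFG).
  have /functional_extensionality-> := def_FI dm (eF _ _ hx) (eF _ _ hy)
    (eF _ _ hz) (eF _ _ hu) (eF _ _ hv).
  have GD c c' w w' w'' : G (fun n => w n + c *: w' n + c' *: w'' n) =
      fun n => G w n + c *: G w' n + c' *: G w'' n.
    have -> : (fun n => w n + c *: w' n + c' *: w'' n) =
        fun n => c' *: w'' n + (fun n => c *: w' n + w n) n.
      apply: functional_extensionality => ?.
      by rewrite addrC; congr (_ + _); rewrite addrC.
    rewrite !tlinearP //; apply: functional_extensionality => ?.
    by rewrite addrC; congr (_ + _); rewrite addrC.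
  by rewrite GD.
move=> h i j k a x y z ha hx hy hz n; rewrite !bE.
have -> : (fun q => act R a (z q)) = actt a z by [].
rewrite F_actt.
have /functional_extensionality e := def_R2 dm ha (eF _ _ hx) (eF _ _ hy) (eF _ _ hz).
have -> : brt m (F x) (F y) (actt a (F z)) = _ := e.
have := tlinearP ((-1) ^+ (h * (i + j))) (actt a (brt m (F x) (F y) (F z)))
          (anchort R (F x) (F y) a (F z)) tG.
move=> /(congr1 (@^~ n)) /= ->.
(* The anchor term [G (rho(F x, F y)(a) F z)] returns to [rho(x, y)(a) z]: F disappears from the
   first two slots by invariance, and G passes to the third, where it cancels F. *)
by rewrite automorphismV_actt F_anchort automorphismV_anchort (autK aFG).
Qed.

End Transport.

End LieRinehartDeformations.

(** * The Cayley transform of an anchor-skew map *)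

Section Cayley.
Context (K : fieldType) (A : scAlgebra K) (L : superSpace K).
Context (R : lieRinehart3 A L).
Variables (f : L -> L) (n : nat).
Hypotheses (lf : linear f) (ef : degree1 false f) (n_gt0 : (0 < n)%N).
Hypothesis fA : forall a u, f (act R a u) = act R a (f u).
Hypothesis f_anchor : forall a u v w, anchor R a (f u) v w = - anchor R a u (f v) w.

(** The operator [1 + c t^n f]. *)
Definition affinet (c : K) (x : fps L) : fps L := comb 1 n x (fun k => c *: f (x k)).

Lemma affinet_tlinear c : tlinear (affinet c).
Proof.
apply: tlinear_comb; first exact: tlinear_id.
apply: tlinear_map (fun u => c *: f u) _ => b u v.
by rewrite lf scalerDr !scalerA mulrC.
Qed.

Lemma affinet_lead c x : affinet c x 0%N = x 0%N.
Proof. by rewrite /affinet /comb leqNgt n_gt0 addr0 scale1r. Qed.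

Lemma affinet_even c i x : homogt i x -> homogt i (affinet c x).
Proof.
move=> hx k; rewrite /affinet /comb scale1r; apply: homogD => //.
by case: ifP => _; [apply/homogZ/(ef (hx _)) | apply: homog0].
Qed.

Lemma affinet_actt c a x : affinet c (actt R a x) = actt R a (affinet c x).
Proof.
apply: functional_extensionality => k; rewrite /affinet /comb /actt !scale1r.
rewrite (linear_fD (act_linear R a)); congr (_ + _); case: ifP => _.
  by rewrite fA (linear_fZ (act_linear R a)).
by rewrite (linear_f0 (act_linear R a)).
Qed.

(** Both sides are t-trilinear, so the hypothesis [f_anchor] on constants is enough. *)
Lemma anchort_skew a x y z :
  anchort R (fun k => f (x k)) y a z = fun k => - anchort R x (fun k => f (y k)) a z k.
Proof.
have [a1 a2 a3] := anchort_tlinear3 R a; have tf := tlinear_map lf.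
have tN T : tlinear T -> tlinear (fun x : fps L => (fun k => - T x k) : fps L).
  move=> tT; apply: (tlinear_comp (tlinear_map (g := -%R) _) tT) => b u v.
  by rewrite opprD scalerN.
pose B x y z := anchort R (fun k => f (x k)) y a z.
pose C x y z := (fun k => - anchort R x (fun k => f (y k)) a z k) : fps L.
have tB : tlinear3 B.
  split=> [y' z'|x' z'|x' y']; [exact: tlinear_comp (a1 _ _) tf|exact: a2|exact: a3].
have tC : tlinear3 C.
  split=> [y' z'|x' z'|x' y']; apply: tN; [exact: a1| |exact: a3].
  exact: tlinear_comp (a2 _ _) tf.
apply: (tlinear3_ext tB tC) => u v w.
have fc (p : L) : (fun k => f (const p k)) = const (f p).
  by apply: functional_extensionality => -[|k] //=; apply: linear_f0.
rewrite /B /C !fc !anchort_const; apply: functional_extensionality => -[|k].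
  exact: f_anchor.
by rewrite /actt /= !(linear_f0 (act_linear R _)) oppr0.
Qed.

(* The terms of degree n cancel by skewness; the one of degree 2n is even in c. *)
Lemma anchort_affinet c a x y z :
  anchort R (affinet c x) (affinet c y) a z
  = anchort R (affinet (- c) x) (affinet (- c) y) a z.
Proof.
have [a1 a2 _] := anchort_tlinear3 R a.
have expand b : anchort R (affinet b x) (affinet b y) a z = fun k =>
    anchort R x y a z k + (if (n <= k)%N then if (n <= k - n)%N then
      (b * b) *: anchort R (fun k => f (x k)) (fun k => f (y k)) a z (k - n - n)%N
      else 0 else 0).
  rewrite {1}/affinet a1 (tlinearZ b (fun k => f (x k)) (a1 _ _)) /affinet !a2.
  rewrite !(tlinearZ b (fun k => f (y k)) (a2 _ _)) anchort_skew.
  apply: functional_extensionality => k; rewrite /comb !scale1r.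
  case: leqP => nk; last by rewrite !addr0.
  rewrite -addrA; congr (_ + _); rewrite scalerDr scalerN addrA subrr add0r.
  by case: ifP; rewrite ?scaler0 ?scalerA.
by rewrite !expand mulrNN.
Qed.

(* The Cayley transform: unlike exp (t^n f), it exists whenever 2 <> 0. *)
Lemma cayley_transform : 2%N \notin [pchar K] -> exists F G,
  [/\ automorphismt F G,
      forall a z, F (actt R a z) = actt R a (F z),
      forall a x y z, anchort R (F x) (F y) a z = anchort R x y a z
    & forall x k, (k <= n)%N -> F x k = x k + (if k == n then f (x 0%N) else 0)].
Proof.
move=> char2; have two_neq0 : 2%:R != 0 :> K.
  by apply: contraNneq char2 => e; rewrite inE /= e eqxx.
pose h : K := 2%:R^-1.
have aU c : automorphismt (affinet c) (tinv (affinet c)).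
  apply: aut_tinv; [exact: affinet_tlinear|exact: affinet_lead|exact: affinet_even].
(* With [h = 1/2] this is the Cayley transform; its inverse is obtained by replacing h with
   [- h]. *)
exists (affinet h \o tinv (affinet (- h))),
  (affinet (- h) \o tinv (affinet h)).
split.
- exact: aut_comp (aU h) (aut_sym (aU (- h))).
- move=> a z /=; rewrite -affinet_actt; congr (affinet h _).
  rewrite -[z in LHS](autVK (aU (- h))) -affinet_actt.
  by rewrite (autK (aU (- h))).
(* The sign of h may be flipped in both slots at once; the factors [1 - h t^n f] then cancel against
   their inverses. *)
- move=> a x y z /=; rewrite anchort_affinet.
  by rewrite !(autVK (aU (- h))).
(* With [x = y - h t^n f(y)] and [F x = y + h t^n f(y)], the difference is [t^n f(y)], whose
   coefficient n is [f (y 0) = f (x 0)]. *)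
move=> x k kn /=; set y := tinv _ x.
have ey : affinet (- h) y = x by rewrite (autVK (aU (- h))).
have ey0 : y 0%N = x 0%N by rewrite -ey affinet_lead.
clearbody y; rewrite -ey /affinet /comb !scale1r; case: (ltngtP k n) kn => // [kn|->] _.
  by rewrite !addr0.
rewrite subnn leqNgt n_gt0 addr0 -addrA; congr (_ + _).
have hh : h + h = 1 by rewrite -mulr2n -mulr_natr mulVf.
by apply/eqP; rewrite eq_sym scaleNr addrC subr_eq -scalerDl hh scale1r.
Qed.

End Cayley.

(** * The higher coefficients of a deformation are cochains *)

Section Infinitesimal.
Context (K : fieldType) (A : scAlgebra K) (L : superSpace K).
Context (R : lieRinehart3 A L) (m : nat -> L -> L -> L -> L).
Hypothesis dm : deformation R m.

Lemma deformation_skew n : super_skew3 (m n).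
Proof.
move=> i j k x y z hx hy hz.
have := def_skew dm (homogt_const hx) (homogt_const hy) (homogt_const hz) n.
by rewrite !(brt_const (def_trilinear dm)).
Qed.

(** The anchor does not depend on t, so on constant arguments the anchor term of (R2) lives in
    degree 0 only. *)
Lemma deformation_actr n : (0 < n)%N -> forall h i j k a x y z,
  homog h a -> homog i x -> homog j y -> homog k z ->
  m n x y (act R a z) = (-1) ^+ (h * (i + j)) *: act R a (m n x y z).
Proof.
move=> n_gt0 h i j k a x y z ha hx hy hz.
have lm := def_trilinear dm.
have := def_R2 dm ha (homogt_const hx) (homogt_const hy) (homogt_const hz) n.
have -> : (fun q => act R a (const z q)) = const (act R a z).
  apply: functional_extensionality => -[|q] //=.
  exact: linear_f0 (act_linear R a).
rewrite !(brt_const lm) anchort_const /actt; case: n n_gt0 => // n _ /=.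
by rewrite (linear_f0 (act_linear R _)) addr0.
Qed.

(** Linearity over [A] in the last slot spreads to the others: skew-symmetry moves the argument
    there and back, and the signs are compared parity by parity. *)
Lemma deformation_C1 n : (0 < n)%N -> C1 R false (m n).
Proof.
move=> n_gt0; have sk := deformation_skew n.
have ar := deformation_actr n_gt0.
split=> //; [exact: def_trilinear dm n|exact: def_even dm n|].
move=> h i j k a x y z ha hx hy hz.
have hact l u : homog l u -> homog (h (+) l) (act R a u).
  exact: act_even (lr_module R) _ _ _ _ ha.
have actZ := linear_fZ (act_linear R a); have actN := linear_fN (act_linear R a).
have e2 i' x' : homog i' x' -> m n x' (act R a y) z =
    (-1) ^+ (h * i') *: act R a (m n x' y z).
  move=> hx'; have [_ ->] := sk _ _ _ _ _ _ hx' (hact _ _ hy) hz.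
  rewrite (ar _ _ _ _ _ _ _ _ ha hx' hz hy).
  have [_ ->] := sk _ _ _ _ _ _ hx' hy hz.
  rewrite actN actZ !scalerN !scalerA; congr (- (_ *: _)).
  by case: (h) (i') (j) (k) => [] [] [] [] /=;
    rewrite ?(expr0, expr1, expr2, mulr1, mul1r, mulrNN, exprS).
split.
- have [-> _] := sk _ _ _ _ _ _ (hact _ _ hx) hy hz.
  have [_ ->] := sk _ _ _ _ _ _ hy (hact _ _ hx) hz.
  rewrite (ar _ _ _ _ _ _ _ _ ha hy hz hx).
  have [-> _] := sk _ _ _ _ _ _ hx hy hz.
  have [_ ->] := sk _ _ _ _ _ _ hy hx hz.
  rewrite !(actN, actZ, scalerN, opprK, scalerA); congr (_ *: _).
  by case: (h) (i) (j) (k) => [] [] [] [] /=;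
    rewrite ?(expr0, expr1, expr2, mulr1, mul1r, mulrNN, exprS).
- by rewrite (e2 _ _ hx) addn0.
by rewrite (ar _ _ _ _ _ _ _ _ ha hx hy hz) addn0.
Qed.

End Infinitesimal.

(** * Coboundaries that occur as coefficients of a deformation *)

Section Coboundaries.
Context (K : fieldType) (A : scAlgebra K) (L : superSpace K).
Context (R : lieRinehart3 A L).

Lemma homog_disjoint (V : superSpace K) i (v : V) :
  homog i v -> homog (~~ i) v -> v = 0.
Proof. by case: i => h0 h1; apply: homog_direct. Qed.

Lemma delta3LR_homog d f i j k x y z : degree1 d f ->
  homog i x -> homog j y -> homog k z ->
  homog (d (+) (i (+) j (+) k)) (delta3LR R d f i j x y z).
Proof.
move=> df hx hy hz; have eb := lie3_even (lr_lie3 R).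
have h1 := eb _ _ _ _ _ _ (df _ _ hx) hy hz.
have h2 := eb _ _ _ _ _ _ hx (df _ _ hy) hz.
have h3 := eb _ _ _ _ _ _ hx hy (df _ _ hz).
apply: homogD; [apply: homogD; [apply: homogD|]|].
- by apply: df; apply: eb hx hy hz.
- by apply: homogN; move: h1; rewrite !addbA.
- by apply/homogN/homogZ; move: h2; rewrite !addbA (addbC i d).
by apply/homogN/homogZ; move: h3; rewrite !addbA (addbC d i) (addbAC i d j).
Qed.

(** The even case of [delta3LR]: free of signs, it makes sense on all elements and is trilinear
    there. *)
Definition delta0 (f : L -> L) (x y z : L) : L :=
  f (br R x y z) - br R (f x) y z - br R x (f y) z - br R x y (f z).

Lemma delta0_trilinear f : linear f -> trilinear (delta0 f).
Proof.
move=> lf; have [b1 b2 b3] := lie3_trilinear (lr_lie3 R).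
have D (a : K) (p q p' q' : L) :
    (a *: p + q) - (a *: p' + q') = a *: (p - p') + (q - q').
  by rewrite scalerBr opprD addrACA.
split=> [y z|x z|x y] a u v; rewrite /delta0.
- by rewrite !(b1 y z, lf, b1 (f y) z, b1 y (f z)) !D.
- by rewrite !(b2 x z, lf, b2 (f x) z, b2 x (f z)) !D.
by rewrite !(b3 x y, lf, b3 (f x) y, b3 x (f y)) !D.
Qed.

Variables (m : nat -> L -> L -> L -> L) (n : nat).
Hypotheses (dm : deformation R m) (n_gt0 : (0 < n)%N).

(** On homogeneous arguments the contribution of the odd part has odd degree relative to them, yet
    it equals [m n] minus the even contribution, which has even relative degree; so it vanishes. *)
Lemma coboundary_even : coboundary R (m n) ->
  exists2 f, C0 R false f & forall x y z, m n x y z = delta0 f x y z.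
Proof.
move=> [f0 [f1 [[lf0 df0 Af0] [lf1 df1 Af1] e]]]; exists f0 => //.
apply: trilinear_homog_eq; [exact: def_trilinear dm n|exact: delta0_trilinear|].
move=> i j k x y z hx hy hz; have := e _ _ _ _ _ _ hx hy hz.
set D0 := delta3LR R false _ _ _ _ _ _; set D1 := delta3LR R true _ _ _ _ _ _ => emn.
have -> : delta0 f0 x y z = D0.
  by rewrite /D0 /delta3LR !muln0 expr0 !scale1r.
rewrite emn (_ : D1 = 0) ?addr0 //.
have h0 : homog (i (+) j (+) k) D0 := delta3LR_homog df0 hx hy hz.
have h1 : homog (~~ (i (+) j (+) k)) D1 := delta3LR_homog df1 hx hy hz.
apply: homog_disjoint h1.
have -> : D1 = m n x y z - D0 by rewrite emn addrC addKr.
by apply: homogD; [apply: def_even dm n _ _ _ _ _ _ hx hy hz|apply: homogN].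
Qed.

Lemma C0_actE f : C0 R false f -> forall a u, f (act R a u) = act R a (f u).
Proof.
move=> [lf _ Af] a u.
apply: (linear_homog_eq (f := fun a => f (act R a u)) (g := fun a => act R a (f u))).
- by move=> c p q; rewrite act_linearl lf.
- by move=> c p q; rewrite act_linearl.
by move=> h {}a ha; rewrite (Af h) // muln0 expr0 scale1r.
Qed.

(* [m n] being A-linear in z, so is the coboundary of f; the anchor terms of
   (R2) obstructing this must therefore cancel. *)
Lemma coboundary_anchor f : C0 R false f ->
  (forall x y z, m n x y z = delta0 f x y z) ->
  forall a x y z, anchor R a (f x) y z = - anchor R a x (f y) z.
Proof.
move=> C0f emn a x y z; have [lf df _] := C0f; have fA := C0_actE C0f.
have rl u v : linear (rho R u v) := rep_linear (lr_rep R) u v.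
apply: (linear_homog_eq (f := fun a => anchor R a (f x) y z)
  (g := fun a => - anchor R a x (f y) z)) a.
- by move=> c p q; rewrite /anchor rl act_linearl.
- by move=> c p q; rewrite /anchor rl act_linearl opprD scalerN.
move=> h a ha; move: x y z; have [t1 t2 t3] := anchor_trilinear R a.
apply: trilinear_homog_eq.
- by split=> [y z|x z|x y] c u v; rewrite ?lf ?t1 ?t2 ?t3.
- by split=> [y z|x z|x y] c u v; rewrite ?lf ?t1 ?t2 ?t3 opprD scalerN.
move=> i j k x y z hx hy hz.
have := deformation_actr dm n_gt0 ha hx hy hz; rewrite !emn /delta0 fA.
rewrite (lr_R2 R ha hx hy hz) (lr_R2 R ha (df _ _ hx) hy hz).
rewrite (lr_R2 R ha hx (df _ _ hy) hz) (lr_R2 R ha hx hy (df _ _ hz)) /=.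
rewrite lf fA; have aD := linear_fD (act_linear R a).
have aN := linear_fN (act_linear R a).
rewrite !aD !aN !scalerDr !scalerN fA -!/(anchor R _ _ _ _).
(* Here u and v are the anchor terms of [f x] and [f y]. The term w, with [f z], occurs twice and
   cancels, since f commutes with the action. *)
have cancel_anchor (p q r s u v w : L) :
    p + w - (q + u) - (r + v) - (s + w) = p - q - r - s -> u = - v.
  rewrite !opprD !addrA [LHS](ACl (1*3*5*7*(2*8)*(4*6)))%AC /= addrN addr0.
  rewrite -[RHS]addr0 => /addrI/eqP; rewrite -opprD oppr_eq0 addr_eq0.
  by move/eqP.
exact: cancel_anchor.
Qed.

End Coboundaries.

(** * Conjugation modulo [t^(n+1)] *)

Section Step.
Context (K : fieldType) (L : superSpace K).

Lemma tlinear3_causal (B : fps L -> fps L -> fps L -> fps L) n x y z x' y' z' :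
  tlinear3 B -> (forall k, (k <= n)%N -> [/\ x k = x' k, y k = y' k & z k = z' k]) ->
  B x y z n = B x' y' z' n.
Proof.
move=> [b1 b2 b3] e.
rewrite (tlinear_causal (b1 y z) (y := x')) => [|k /e[]//].
rewrite (tlinear_causal (b2 x' z) (y := y')) => [|k /e[]//].
by apply: tlinear_causal (b3 x' y') _ => k /e[].
Qed.

Lemma conj_bracket_lead F G (m : nat -> L -> L -> L -> L) f n :
  (0 < n)%N -> automorphismt F G -> (forall i, trilinear (m i)) ->
  (forall x k, (k <= n)%N -> F x k = x k + (if k == n then f (x 0%N) else 0)) ->
  forall x y z k, (k <= n)%N ->
  conj_bracket F G m k x y z = m k x y z
    + if k == n then m 0%N (f x) y z + m 0%N x (f y) z + m 0%N x y (f z)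
                     - f (m 0%N x y z) else 0.
Proof.
move=> n_gt0 aFG lm eF x y z k kn; have tB := brt_tlinear3 lm; have [b1 b2 b3] := tB.
set B := brt m (F (const x)) (F (const y)) (F (const z)).
have G0 w : G w 0%N = w 0%N := aut_leadV aFG w.
have B0 : B 0%N = m 0%N x y z by rewrite /B brt_coef0 !(aut_lead aFG).
(* Writing [B = F (G B)] avoids expanding G: only the known low coefficients of F enter. *)
have eG : B k = conj_bracket F G m k x y z + if k == n then f (m 0%N x y z) else 0.
  by rewrite -B0 -(G0 B) -(eF (G B) _ kn) (autVK aFG).
(* By causality F may be replaced on constants by its truncation [u + t^n f(u)]. *)
pose X u : fps L := comb 1 n (const u) (const (f u)).
have eX u i : (i <= k)%N -> F (const u) i = X u i.
  move=> ik; have ni := leq_trans ik kn; rewrite eF // /X /comb scale1r /=.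
  congr (_ + _); rewrite eqn_leq ni /=; case: ifP => // ne.
  by rewrite (_ : i - n = 0)%N //; apply/eqP; rewrite subn_eq0.
have X0 u : X u 0%N = u.
  by rewrite /X /comb leqNgt n_gt0 addr0 scale1r.
have : B k = brt m (X x) (X y) (X z) k.
  by apply: tlinear3_causal tB _ => i ik; rewrite !eX.
rewrite {1}/X b1 {1}/comb {1}/X b2 {1}/comb {1}/X b3 {1}/comb !scale1r.
rewrite brt_const // eG => /(canRL (addrK _)) ->.
case: ltngtP kn => // [kn|->] _; first by rewrite !addr0 subr0.
(* At [k = n] each term carrying [t^n] contributes its constant coefficient, where [X u] is u;
   products of two corrections start in degree 2n. *)
rewrite subnn !brt_coef0 !X0 //= -!addrA; congr (_ + _).
by rewrite !addrA [LHS](ACl (3*2*1*4))%AC.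
Qed.

End Step.

(** The invariant varies with the stage, so the recursion runs through the subset types
    [{t | P n t}]. *)
Lemma dependent_choice (T : Type) (P : nat -> T -> Prop) (Q : nat -> T -> T -> Prop)
    (t0 : T) : P 0%N t0 ->
  (forall n t, P n t -> exists t', P n.+1 t' /\ Q n t t') ->
  exists s : nat -> T, forall n, P n (s n) /\ Q n (s n) (s n.+1).
Proof.
move=> P0 step.
pose next n (t : {t | P n t}) : {t' | P n.+1 t' /\ Q n (sval t) t'} :=
  constructive_indefinite_description _ (step n _ (svalP t)).
pose s := fix s n : {t | P n t} := if n is n'.+1
  then exist (P n'.+1) _ (svalP (next n' (s n'))).1 else exist (P 0%N) t0 P0.
exists (fun n => sval (s n)) => n; split; first exact: svalP (s n).
exact: (svalP (next n (s n))).2.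
Qed.

(** * The t-adic limit of a sequence of automorphisms *)

Section Limit.
Context (K : fieldType) (L : superSpace K).
Variables (F G : nat -> fps L -> fps L).
Hypothesis aFG : forall n, automorphismt (F n) (G n).
Hypothesis stable : forall n x k, (k <= n)%N ->
  F n.+1 x k = F n x k /\ G n.+1 x k = G n x k.

(** The diagonal is the t-adic limit, because under [stable] coefficient n is frozen from stage n
    on. *)
Definition limt (H : nat -> fps L -> fps L) (x : fps L) : fps L := fun n => H n x n.

Lemma limtE n x k : (k <= n)%N -> F n x k = limt F x k /\ G n x k = limt G x k.
Proof.
elim: n => [|n IHn]; rewrite leq_eqVlt => /orP[/eqP-> //|//].
by rewrite ltnS => kn; have [-> ->] := stable x kn; apply: IHn.
Qed.

(** By causality coefficient n of each identity involves only coefficients up to n, where the limit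
    agrees with stage n. *)
Lemma limt_automorphismt : automorphismt (limt F) (limt G).
Proof.
split=> [a s x y|a s x y|x|x|x|i x hx n|i x hx n].
- apply: functional_extensionality => n; rewrite /limt (aut_tlinear (aFG n)).
  rewrite /comb; case: leqP => // sn.
  by have [-> _] := limtE y (leq_subr s n).
- apply: functional_extensionality => n; rewrite /limt (aut_tlinearV (aFG n)).
  rewrite /comb; case: leqP => // sn.
  by have [_ ->] := limtE y (leq_subr s n).
- apply: functional_extensionality => n.
  rewrite -[RHS](congr1 (@^~ n) (autK (aFG n) x)).
  by apply: tlinear_causal (aut_tlinearV (aFG n)) _ => k /(limtE x)[->].
- apply: functional_extensionality => n.
  rewrite -[RHS](congr1 (@^~ n) (autVK (aFG n) x)).
  by apply: tlinear_causal (aut_tlinear (aFG n)) _ => k /(limtE x)[_ ->].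
- exact: aut_lead (aFG 0%N) x.
- exact: aut_even (aFG n) _ _ hx n.
exact: aut_evenV (aFG n) _ _ hx n.
Qed.

End Limit.

(** * Successive removal of coboundaries and passage to the limit *)

Section Normalisation.
Context (K : fieldType) (A : scAlgebra K) (L : superSpace K).
Context (R : lieRinehart3 A L).
Hypothesis char2 : 2%N \notin [pchar K].

Lemma remove_coboundary m n : deformation R m -> (0 < n)%N -> coboundary R (m n) ->
  exists F G, [/\ automorphismt F G, deformation R (conj_bracket F G m),
    forall x k, (k < n)%N -> F x k = x k,
    forall i, (0 < i < n)%N -> forall x y z, conj_bracket F G m i x y z = m i x y z
    & forall x y z, conj_bracket F G m n x y z = 0].
Proof.
move=> dm n_gt0 cb; have [f C0f emn] := coboundary_even dm cb.
have [lf df _] := C0f; have fA := C0_actE C0f.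
have f_anchor := coboundary_anchor dm n_gt0 C0f emn.
have [F [G [aFG FA Fanchor eF]]] := cayley_transform lf df n_gt0 fA f_anchor char2.
have lead := conj_bracket_lead n_gt0 aFG (def_trilinear dm) eF.
exists F, G; split=> //.
- exact: deformation_conj.
- by move=> x k kn; rewrite (eF _ _ (ltnW kn)) (ltn_eqF kn) addr0.
- move=> i /andP[_ ilt] x y z.
  by rewrite (lead _ _ _ _ (ltnW ilt)) (ltn_eqF ilt) addr0.
move=> x y z; rewrite lead // eqxx emn /delta0 !(def_0 dm).
set p := f _; set q := br _ _ _ _; set r := br _ _ _ _; set t := br _ _ _ _.
have -> : p - q - r - t = - (q + r + t - p) by rewrite opprB !opprD !addrA.
exact: addNr.
Qed.

Variable m : nat -> L -> L -> L -> L.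
Hypothesis dm : deformation R m.

Definition state : Type :=
  (nat -> L -> L -> L -> L) * ((fps L -> fps L) * (fps L -> fps L)).

Definition normalised n (s : state) :=
  let: (m', (F, G)) := s in
  [/\ deformation R m', automorphismt F G,
      forall x y z, brt m' x y z = G (brt m (F x) (F y) (F z))
    & forall i, (0 < i <= n)%N -> forall x y z, m' i x y z = 0].

(** Congruence modulo [t^(n+1)], for the automorphism and for its inverse: the condition that makes
    the composites converge. *)
Definition agree n (s s' : state) :=
  forall x k, (k <= n)%N -> s'.2.1 x k = s.2.1 x k /\ s'.2.2 x k = s.2.2 x k.

Lemma normalise_next n s :
  (forall m', deformation R m' -> equivalent m m' ->
    infinitesimal R m' n.+1 -> coboundary R (m' n.+1)) ->
  normalised n s -> exists s', normalised n.+1 s' /\ agree n s s'.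
Proof.
move: s => [m' [F G]] hcob [dm' aFG em' m'0].
have kill i : (0 < i <= n.+1)%N -> i = n.+1 \/ (0 < i <= n)%N.
  by case/andP=> i0; rewrite leq_eqVlt ltnS i0 => /orP[/eqP|]; [left|right].
(* A vanishing coefficient is not an infinitesimal, so [hcob] says nothing about it; the state is
   then kept unchanged. *)
case: (classic (exists x y z, m' n.+1 x y z <> 0)) => [nz|z0]; last first.
  exists (m', (F, G)); split; last by [].
  split=> // i /kill[-> x y z|]; last exact: m'0.
  by apply: NNPP => nz; apply: z0; exists x, y, z.
have inf : infinitesimal R m' n.+1 by split=> //; exact: deformation_C1.
have [F' [G' [aFG' dc eF' lo hi]]] :=
  remove_coboundary dm' (ltn0Sn n) (hcob _ dm' (aut_equivalent aFG em') inf).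
exists (conj_bracket F' G' m', (F \o F', G' \o G)); split.
  split=> //; first exact: aut_comp.
    by move=> x y z; rewrite brt_conj ?em' //; exact: def_trilinear dm'.
  move=> i /kill[-> x y z|ilt x y z]; first exact: hi.
  by rewrite lo ?m'0.
move=> x k kn; split=> /=.
  apply: tlinear_causal (aut_tlinear aFG) _ => i ik; apply: eF'.
  by rewrite ltnS (leq_trans ik).
(* The inverse [G'] is also the identity up to degree n: [G x] is [F' (G' (G x))], and F' does not
   alter these coefficients. *)
by rewrite -[in RHS](autVK aFG' (G x)) eF'.
Qed.

Lemma trivial_of_coboundaries :
  (forall m' n, deformation R m' -> equivalent m m' ->
    infinitesimal R m' n -> coboundary R (m' n)) ->
  trivial_deformation R m.
Proof.
move=> hcob.
have n0 : normalised 0 (m, (id, id)).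
  by split=> // -[].
have [s hs] := dependent_choice n0 (fun n s => @normalise_next n s (hcob^~ n.+1)).
pose F n := (s n).2.1; pose G n := (s n).2.2.
have hn n : [/\ deformation R (s n).1, automorphismt (F n) (G n),
      forall x y z, brt (s n).1 x y z = G n (brt m (F n x) (F n y) (F n z))
    & forall i, (0 < i <= n)%N -> forall x y z, (s n).1 i x y z = 0].
  by have [+ _] := hs n; rewrite /F /G; case: (s n) => m' [].
have aFG n : automorphismt (F n) (G n) by have [] := hn n.
have st n x k : (k <= n)%N -> F n.+1 x k = F n x k /\ G n.+1 x k = G n x k.
  by have [_] := hs n; apply.
apply: (aut_equivalent (limt_automorphismt aFG st)) => x y z.
apply: functional_extensionality => n.
have [dn an en zn] := hn n.
have eF w k : (k <= n)%N -> limt F w k = F n w k by move=> /(limtE st w)[->].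
(* Coefficient n involves only brackets of index at most n, and at stage n those of index 1 to n are
   zero. *)
have -> : brt (undeformed R) x y z n = brt (s n).1 x y z n.
  apply: eq_bigr => -[[|h] hn'] _; do 3![apply: eq_bigr => ? _] => /=.
    by rewrite (def_0 dn).
  by rewrite zn.
rewrite en; apply: tlinear_causal (aut_tlinearV an) _ => k kn.
apply: tlinear3_causal (brt_tlinear3 (def_trilinear dm)) _ => i ik.
by rewrite !eF // (leq_trans ik kn).
Qed.

End Normalisation.

Theorem theorem3p19 (K : fieldType) (hK : 2%N \notin [pchar K])
    (A : scAlgebra K) (L : superSpace K) (R : lieRinehart3 A L)
    (m : nat -> L -> L -> L -> L) :
  deformation R m -> ~ trivial_deformation R m ->
  exists m' : nat -> L -> L -> L -> L,
    [/\ deformation R m', equivalent m m'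
      & exists n : nat, infinitesimal R m' n /\ ~ coboundary R (m' n)].
Proof.
move=> dm nontrivial; apply: NNPP => none; apply: nontrivial.
apply: trivial_of_coboundaries => // m' n dm' eqm inf.
by apply: NNPP => ncob; apply: none; exists m'; split=> //; exists n.
Qed.
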